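(* Let $\delta\ge 0$. Any persistence module $W$ over $\Delta_0\cup\Delta_\delta$ extends to a persistence module $\overline{W}$ over the diagonal strip $$\Delta_{[0,\delta]}=\{(p,q)\in\mathbf{R}^2\mid 0\le q-p\le 2\delta\}.$$
   Context: Fix an arbitrary field $\mathbf{k}$; all vector spaces are over $\mathbf{k}$. A persistence module $V$ over a partially ordered set $T$ consists of vector spaces $(V_t\mid t\in T)$ and linear maps $v_s^t:V_s\to V_t$ for all $s\le t$ in $T$, such that $v_t^t$ is the identity and $v_s^t\circ v_r^s=v_r^t$ whenever $r\le s\le t$. If $S\subseteq T$, the restriction of $V$ to $S$ is the persistence module over $S$ (with the induced order) given by the spaces and maps with indices in $S$; a module over $T$ extends a module over $S$ if its restriction to $S$ is that module. $\mathbf{R}^2$ and its subsets carry the partial order $(p_1,q_1)\le(p_2,q_2)\iff p_1\le p_2$ and $q_1\le q_2$. For real $x$, $\Delta_x=\{(p,q)\in\mathbf{R}^2\mid q-p=2x\}$. *)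

(* Defs.v *)
From HB Require Import structures.
From mathcomp Require Import all_boot all_order all_algebra.
From mathcomp Require Import mathcomp_extra boolp classical_sets reals.

Set Implicit Arguments.
Unset Strict Implicit.
Unset Printing Implicit Defensive.

Import Order.TTheory GRing.Theory Num.Theory.

Local Open Scope classical_set_scope.
Local Open Scope ring_scope.

(* In [pm_map_id] and [pm_map_comp] the proofs of the inequalities are
   arbitrary; they are proofs of boolean equations, hence unique. *)
Record pmodule (k : fieldType) (d : Order.disp_t) (T : porderType d) := PModule {
  pm_space :> T -> lmodType k;
  pm_map : forall s t : T, (s <= t)%O -> {linear pm_space s -> pm_space t};
  pm_map_id : forall (t : T) (tt : (t <= t)%O) (x : pm_space t),
    pm_map tt x = x;
  pm_map_comp : forall (r s t : T) (rs : (r <= s)%O) (st : (s <= t)%O)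
      (rt : (r <= t)%O) (x : pm_space r),
    pm_map st (pm_map rs x) = pm_map rt x }.

HB.instance Definition _ (d : Order.disp_t) (T : porderType d) (P : pred T) :=
  [SubChoice_isSubPOrder of {x : T | P x} by <: with d].

Section Restriction.
Variables (k : fieldType) (d : Order.disp_t) (T : porderType d) (A B : set T).

Definition set_incl (AB : A `<=` B) (a : A) : B :=
  exist _ (val a) (mem_set (AB _ (set_mem (valP a)))).

Lemma set_incl_le (AB : A `<=` B) (a b : A) :
  (a <= b)%O -> (set_incl AB a <= set_incl AB b)%O.
Proof. by []. Qed.

Definition restrict (AB : A `<=` B) (V : pmodule k B) : pmodule k A :=
  @PModule k _ A
    (fun a => V (set_incl AB a))
    (fun a b ab => pm_map V (set_incl_le AB ab))
    (fun a aa => pm_map_id (set_incl_le AB aa))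
    (fun a b c ab bc ac =>
      pm_map_comp (set_incl_le AB ab) (set_incl_le AB bc) (set_incl_le AB ac)).

Definition extends (V : pmodule k B) (W : pmodule k A) : Prop :=
  exists AB : A `<=` B, restrict AB V = W.

End Restriction.

(* [R *p R] is [R * R] with the product order. *)
Definition diag_line (R : realType) (x : R) : set (R *p R) :=
  [set pq | pq.2 - pq.1 = 2 * x].

Definition diag_strip (R : realType) (delta : R) : set (R *p R) :=
  [set pq | 0 <= pq.2 - pq.1 <= 2 * delta].

(* Main.v *)
(** Every module over a full subposet extends to the whole poset, by the
    right Kan extension: the space at [t] consists of the compatible families
    of elements of the spaces of [W] at the points of the subposet above [t].
    At a point [s] of the subposet a family is determined by its value at [s],
    so the Kan extension restricts to [W] up to isomorphism; replacing the
    spaces at these points by those of [W] makes the restriction equal to [W].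
    The strip enters only through its containing the two diagonals. *)
Require Import Defs.
From HB Require Import structures.
From mathcomp Require Import all_boot all_order all_algebra.
From mathcomp Require Import boolp classical_sets reals.

Import Order.TTheory GRing.Theory Num.Theory.

Local Open Scope classical_set_scope.
Local Open Scope ring_scope.

Set Implicit Arguments.
Unset Strict Implicit.
Unset Printing Implicit Defensive.

(** Linearity is a proposition, so function extensionality and proof irrelevance suffice. *)
Lemma linear_ext (k : fieldType) (U V : lmodType k) (f g : {linear U -> V}) :
  f =1 g -> f = g.
Proof.
case: f g => [f [[fD] [fZ]]] [g [[gD] [gZ]]] /= /funext fg.
by case: _ / fg in gD gZ *; congr GRing.Linear.Pack; congr GRing.Linear.Class;
  congr (_ _); apply: Prop_irrelevance.
Qed.

(** Both modules are built on the same [X], so their maps are compared without casts; the module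
    laws are propositions. *)
Lemma pmodule_ext (k : fieldType) (d : Order.disp_t) (T : porderType d)
    (X : T -> lmodType k)
    (m m' : forall s t : T, (s <= t)%O -> {linear X s -> X t}) mid mid' mc mc' :
  (forall s t (st : (s <= t)%O), m s t st =1 m' s t st) ->
  @PModule k d T X m mid mc = @PModule k d T X m' mid' mc'.
Proof.
move=> mm'; have {mm'} eq_m : m = m'.
  by do 3![apply: functional_extensionality_dep => ?]; apply/linear_ext/mm'.
by case: _ / eq_m in mid' mc' *; congr PModule; apply: Prop_irrelevance.
Qed.

Lemma pmodule_eta (k : fieldType) (d : Order.disp_t) (T : porderType d)
    (V : pmodule k T) : V = PModule (@pm_map_id _ _ _ V) (@pm_map_comp _ _ _ V).
Proof. by case: V. Qed.

(** The new space is a field, so that a family of such isomorphisms also chooses the replacement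
    space at every index. *)
Record iso_to (k : fieldType) (V : lmodType k) := IsoTo {
  iso_space : lmodType k;
  iso_fun : {linear iso_space -> V};
  iso_inv : {linear V -> iso_space};
  iso_funK : cancel iso_fun iso_inv;
  iso_invK : cancel iso_inv iso_fun }.

Definition iso_refl (k : fieldType) (V : lmodType k) : iso_to V :=
  @IsoTo k V V idfun idfun (fun=> erefl) (fun=> erefl).

Section Transport.
Variables (k : fieldType) (d : Order.disp_t) (T : porderType d).
Variables (V : pmodule k T) (phi : forall t, iso_to (V t)).

Definition transport_map (s t : T) (st : (s <= t)%O) :
    {linear iso_space (phi s) -> iso_space (phi t)} :=
  iso_inv (phi t) \o (pm_map V st \o iso_fun (phi s)).

Lemma transport_map_id (t : T) (tt : (t <= t)%O) x : transport_map tt x = x.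
Proof. by rewrite /transport_map /= pm_map_id iso_funK. Qed.

Lemma transport_map_comp (r s t : T) (rs : (r <= s)%O) (st : (s <= t)%O)
    (rt : (r <= t)%O) x :
  transport_map st (transport_map rs x) = transport_map rt x.
Proof. by rewrite /transport_map /= iso_invK (pm_map_comp _ _ rt). Qed.

Definition transport : pmodule k T :=
  PModule transport_map_id transport_map_comp.

End Transport.

Lemma restrict_transport (k : fieldType) (d : Order.disp_t) (T : porderType d)
    (A B : set T) (AB : A `<=` B) (V : pmodule k B)
    (phi : forall b, iso_to (V b)) :
  restrict AB (transport phi) =
  @transport _ _ _ (restrict AB V) (fun a => phi (set_incl AB a)).
Proof. exact: pmodule_ext. Qed.

(** * The right Kan extension along a map of posets *)

Section KanExtension.
Variables (k : fieldType) (d d' : Order.disp_t).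
Variables (S : porderType d) (T : porderType d') (i : S -> T).
Variable W : pmodule k S.

Record family (t : T) := Family {
  family_val : forall s, (t <= i s)%O -> W s;
  family_compat : forall s s' (ts : (t <= i s)%O) (ts' : (t <= i s')%O)
    (ss' : (s <= s')%O), pm_map W ss' (family_val ts) = family_val ts' }.

Lemma family_ext (t : T) (x y : family t) :
  (forall s (ts : (t <= i s)%O), family_val x ts = family_val y ts) -> x = y.
Proof.
case: x y => [x xc] [y yc] /= xy.
have {xy} exy : x = y.
  by do 2![apply: functional_extensionality_dep => ?]; apply: xy.
by case: _ / exy in yc *; congr Family; apply: Prop_irrelevance.
Qed.

(** Classical equality and choice, which an [lmodType] must carry. *)
HB.instance Definition _ t := gen_eqMixin (family t).
HB.instance Definition _ t := gen_choiceMixin (family t).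

Section Operations.
Variable t : T.
Implicit Types x y : family t.

Program Definition family0 : family t := @Family t (fun s _ => 0) _.
Next Obligation. by rewrite linear0. Qed.

Program Definition family_opp x : family t :=
  @Family t (fun s ts => - family_val x ts) _.
Next Obligation. by rewrite linearN; congr (- _); apply: family_compat. Qed.

Program Definition family_add x y : family t :=
  @Family t (fun s ts => family_val x ts + family_val y ts) _.
Next Obligation. by rewrite linearD; congr (_ + _); apply: family_compat. Qed.

Program Definition family_scale (c : k) x : family t :=
  @Family t (fun s ts => c *: family_val x ts) _.
Next Obligation. by rewrite linearZ; congr (_ *: _); apply: family_compat. Qed.

Lemma family_addA : associative family_add.
Proof. by move=> x y z; apply: family_ext => s ts /=; rewrite addrA. Qed.

Lemma family_addC : commutative family_add.
Proof. by move=> x y; apply: family_ext => s ts /=; rewrite addrC. Qed.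

Lemma family_add0 : left_id family0 family_add.
Proof. by move=> x; apply: family_ext => s ts /=; rewrite add0r. Qed.

Lemma family_addN : left_inverse family0 family_opp family_add.
Proof. by move=> x; apply: family_ext => s ts /=; rewrite addNr. Qed.

HB.instance Definition _ := GRing.isZmodule.Build (family t)
  family_addA family_addC family_add0 family_addN.

Lemma family_scaleA a b x :
  family_scale a (family_scale b x) = family_scale (a * b) x.
Proof. by apply: family_ext => s ts /=; rewrite scalerA. Qed.

Lemma family_scale1 : left_id 1 family_scale.
Proof. by move=> x; apply: family_ext => s ts /=; rewrite scale1r. Qed.

Lemma family_scaleDr : right_distributive family_scale +%R.
Proof. by move=> c x y; apply: family_ext => s ts /=; rewrite scalerDr. Qed.

Lemma family_scaleDl x : {morph family_scale^~ x : a b / a + b}.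
Proof. by move=> a b; apply: family_ext => s ts /=; rewrite scalerDl. Qed.

HB.instance Definition _ := GRing.Zmodule_isLmodule.Build k (family t)
  family_scaleA family_scale1 family_scaleDr family_scaleDl.

End Operations.

Definition family_restrict (t u : T) (tu : (t <= u)%O) (x : family t) :
    family u :=
  @Family u (fun s us => family_val x (le_trans tu us))
    (fun s s' us us' ss' => family_compat x _ _ ss').

Lemma family_restrict_linear t u (tu : (t <= u)%O) :
  linear (family_restrict tu).
Proof. by move=> c x y; apply: family_ext. Qed.

HB.instance Definition _ t u (tu : (t <= u)%O) :=
  GRing.isLinear.Build k (family t) (family u) _ (family_restrict tu)
    (family_restrict_linear tu).

Lemma family_restrict_id t (tt : (t <= t)%O) (x : family t) :
  family_restrict tt x = x.
Proof.
by apply: family_ext => s ts /=; congr family_val; apply: bool_irrelevance.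
Qed.

Lemma family_restrict_comp r t u (rt : (r <= t)%O) (tu : (t <= u)%O)
    (ru : (r <= u)%O) (x : family r) :
  family_restrict tu (family_restrict rt x) = family_restrict ru x.
Proof.
by apply: family_ext => s us /=; congr family_val; apply: bool_irrelevance.
Qed.

Definition kan : pmodule k T :=
  @PModule k _ T (fun t => family t) (fun t u tu => family_restrict tu)
    family_restrict_id family_restrict_comp.

Hypothesis i_mono : {mono i : s s' / (s <= s')%O}.

(** * Comparison of the Kan extension with [W] at embedded points *)

Section Unit.
Variable s : S.

(** Order reflection enters here: it supplies the map of [W] from [s] to [s'] whenever [i s'] lies
    above [i s]. *)
Definition unit_le s' (ss' : (i s <= i s')%O) : (s <= s')%O :=
  etrans (esym (i_mono s s')) ss'.

Program Definition kan_unit (w : W s) : family (i s) :=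
  @Family (i s) (fun s' ss' => pm_map W (unit_le ss') w) _.
Next Obligation. exact: pm_map_comp. Qed.

Lemma kan_unit_linear : linear kan_unit.
Proof. by move=> c x y; apply: family_ext => s' ss' /=; rewrite linearP. Qed.

HB.instance Definition _ :=
  GRing.isLinear.Build k (W s) (family (i s)) _ kan_unit kan_unit_linear.

Definition kan_eval (x : family (i s)) : W s := family_val x (lexx (i s)).

Lemma kan_eval_linear : linear kan_eval.
Proof. by []. Qed.

HB.instance Definition _ :=
  GRing.isLinear.Build k (family (i s)) (W s) _ kan_eval kan_eval_linear.

Lemma kan_unitK : cancel kan_unit kan_eval.
Proof. by move=> w; apply: pm_map_id. Qed.

(** Compatibility along [s <= s'] makes the value at [s'] the image of the value at [s]. *)
Lemma kan_evalK : cancel kan_eval kan_unit.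
Proof. by move=> x; apply: family_ext => s' ss'; apply: family_compat. Qed.

(** The direction matters: the new space is [W s] itself, so transport puts exactly this space at
    [i s]. *)
Definition kan_iso : iso_to (kan (i s)) :=
  @IsoTo k (kan (i s)) (W s) kan_unit kan_eval kan_unitK kan_evalK.

End Unit.

(** Excluded middle decides whether [t] is in the image of [i]; if so, a preimage [s] is chosen and
    [kan_iso s] is cast along [i s = t]. *)
Definition strict_iso (t : T) : iso_to (kan t) :=
  match pselect (exists s, i s = t) with
  | left e => let: exist s st := cid e in ecast t (iso_to (kan t)) st (kan_iso s)
  | right _ => iso_refl (kan t)
  end.

(** An order embedding is injective, so the chosen preimage of [i s] is [s], and the cast is along a
    proof equal to [erefl]. *)
Lemma strict_iso_embed s : strict_iso (i s) = kan_iso s.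
Proof.
rewrite /strict_iso; case: pselect => [e|]; last by case; exists s.
case: cid => s' e'; have ss' : s' = s by apply: (inc_inj i_mono).
by case: _ / ss' in e' *; rewrite (Prop_irrelevance e' erefl).
Qed.

End KanExtension.

Lemma extends_subset (k : fieldType) (d : Order.disp_t) (T : porderType d)
    (A B : set T) (W : pmodule k A) :
  A `<=` B -> exists V : pmodule k B, extends V W.
Proof.
move=> AB; have i_mono : {mono set_incl AB : a b / (a <= b)%O} by [].
exists (transport (strict_iso W i_mono)), AB; rewrite restrict_transport.
(* This makes the space at [a] convertible to [W a], as [pmodule_ext] requires. *)
have -> : (fun a => strict_iso W i_mono (set_incl AB a)) = kan_iso W i_mono.
  by apply: functional_extensionality_dep => a; apply: strict_iso_embed.
rewrite [RHS]pmodule_eta; apply: pmodule_ext => a b ab w.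
(* The family generated by [w], restricted and evaluated at [b], is the image of [w] under the map
   of [W] from [a] to [b], up to the proof of [a <= b]. *)
by rewrite /transport_map /= /kan_eval /=; congr (pm_map W _ w);
  apply: bool_irrelevance.
Qed.

Theorem theorem3p5 (k : fieldType) (R : realType) (delta : R)
    (delta_ge0 : 0 <= delta)
    (W : pmodule k (diag_line (0 : R) `|` diag_line delta)) :
  exists Wbar : pmodule k (diag_strip delta), extends Wbar W.
Proof.
(* The difference of coordinates is [2 * 0] on one diagonal and [2 * delta] on the other; both lie
   in the range since [delta] is nonnegative. *)
apply: extends_subset => pq; rewrite /diag_strip /diag_line /= => -[] ->.
  by rewrite mulr0 lexx mulr_ge0.
by rewrite lexx mulr_ge0.
Qed.
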